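(* Let $A=\coprod_{n\in\mathbb{N}}A_{(n)}$ be an $\mathbb{N}$-graded vertex Poisson algebra with derivation $\partial$ and operations $(a,b)\mapsto a_nb$ ($n\in\mathbb{N}$). Then $A_{(0)}$ being a unital commutative associative algebra and $A_{(1)}$ an $A_{(0)}$-module (under the product of $A$), the space $A_{(1)}$ is a Courant $A_{(0)}$-algebroid, with structure maps given by $$[u,v]=u_0v,\qquad \langle u,v\rangle=u_1v,\qquad \pi(u)(a)=u_0a\qquad (u,v\in A_{(1)},\ a\in A_{(0)})$$ and with the derivation $\partial|_{A_{(0)}}:A_{(0)}\to A_{(1)}$.
   Context: All vector spaces are over $\mathbb{C}$ and $\mathbb{N}=\{0,1,2,\dots\}$. For a formal series $f(x_1,\dots,x_n)=\sum_{m_i\in\mathbb{Z}}u(m_1,\dots,m_n)x_1^{-m_1-1}\cdots x_n^{-m_n-1}$, $\mathrm{Sing}\,f$ denotes the part of the sum with all $m_i\in\mathbb{N}$. Powers $(x_1-x_2)^{-k}$ are expanded in nonnegative powers of $x_2$. A vertex Lie algebra is a vector space $A$ with a linear operator $\partial$ and a linear map $Y_-:A\to\mathrm{Hom}(A,x^{-1}A[x^{-1}])$, $a\mapsto Y_-(a,x)=\sum_{n\in\mathbb{N}}a_nx^{-n-1}$ ($a_n\in\mathrm{End}\,A$), such that for $a,b\in A$: $a_nb=0$ for $n$ sufficiently large; $Y_-(\partial a,x)=\frac{d}{dx}Y_-(a,x)$; $Y_-(a,x)b=\mathrm{Sing}(e^{x\partial}Y_-(b,-x)a)$; $[Y_-(a,x_1),Y_-(b,x_2)]=\mathrm{Sing}(Y_-(Y_-(a,x_1-x_2)b,x_2))$.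 In components: $(\partial a)_nb=-na_{n-1}b$; $a_nb=\sum_{i\ge0}(-1)^{n+i+1}\frac1{i!}\partial^ib_{n+i}a$; $a_mb_nc-b_na_mc=\sum_{i=0}^m\binom mi(a_ib)_{m+n-i}c$, for $a,b,c\in A$, $m,n\in\mathbb{N}$. A differential algebra is a commutative associative algebra with identity $1$ together with a derivation $\partial$. A vertex Poisson algebra is a differential algebra $(A,\partial)$ with a vertex Lie algebra structure $(Y_-,\partial)$ (same $\partial$) such that $a_n(bc)=(a_nb)c+b(a_nc)$ for $a,b,c\in A$, $n\in\mathbb{N}$. It is $\mathbb{N}$-graded if $A=\coprod_{n\in\mathbb{N}}A_{(n)}$ is a grading of $A$ as an algebra and $\partial A_{(r)}\subset A_{(r+1)}$, $a_mA_{(r)}\subset A_{(r+n-m-1)}$ for $a\in A_{(n)}$, $m,n,r\in\mathbb{N}$ (where $A_{(k)}=0$ for $k<0$). A Leibniz algebra is a vector space with a bilinear bracket satisfying $[u,[v,w]]=[[u,v],w]+[v,[u,w]]$. For a unital commutative associative algebra $\mathcal{A}$, a Leibniz $\mathcal{A}$-algebra is a Leibniz algebra equipped with an $\mathcal{A}$-module structure; $\mathrm{Der}(\mathcal{A})$ is one, via the commutator bracket and the usual module structure, and homomorphisms of Leibniz $\mathcal{A}$-algebras are $\mathcal{A}$-linear Leibniz homomorphisms. A Courant $\mathcal{A}$-algebroid is an $\mathcal{A}$-module $\mathcal{B}$ equipped with a ($\mathbb{C}$-bilinear) Leibniz bracket $[\cdot,\cdot]$ on $\mathcal{B}$, a homomorphism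 of Leibniz $\mathcal{A}$-algebras $\pi:\mathcal{B}\to\mathrm{Der}(\mathcal{A})$, a symmetric $\mathcal{A}$-bilinear pairing $\langle\cdot,\cdot\rangle:\mathcal{B}\otimes_{\mathcal{A}}\mathcal{B}\to\mathcal{A}$, and a derivation $\partial:\mathcal{A}\to\mathcal{B}$ with $\pi\circ\partial=0$, such that for $a\in\mathcal{A}$, $u,v,w\in\mathcal{B}$: $[u,av]=a[u,v]+\pi(u)(a)v$; $\langle[u,v],w\rangle+\langle v,[u,w]\rangle=\pi(u)\langle v,w\rangle$; $[u,\partial a]=\partial(\pi(u)a)$; $\langle u,\partial a\rangle=\pi(u)a$; $[u,v]+[v,u]=\partial\langle u,v\rangle$. *)

(* Defs.v *)
(* The scalars K below are specialized to the complex numbers R[i],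
   R : realType. *)
From HB Require Import structures.
From mathcomp Require Import all_boot all_order all_algebra.
From mathcomp Require Import boolp functions.
From mathcomp Require Export reals complex.

Set Implicit Arguments.
Unset Strict Implicit.
Unset Printing Implicit Defensive.

Import GRing.Theory.
Local Open Scope ring_scope.

(* Unital commutative associative K-algebras. MathComp's comAlgType is not
   used because it forces 1 != 0, which excludes the zero algebra. *)
Record comAlgebra (K : pzRingType) := ComAlgebra {
  calg_ring : comPzRingType;
  calg_scale : K -> calg_ring -> calg_ring;
  calg_scalerA : forall k l a,
    calg_scale k (calg_scale l a) = calg_scale (k * l) a;
  calg_scale1r : left_id 1 calg_scale;
  calg_scalerDr : right_distributive calg_scale +%R;
  calg_scalerDl : forall a, {morph calg_scale^~ a : k l / k + l};
  calg_scalerAl : forall k a b, calg_scale k (a * b) = calg_scale k a * b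
}.

Definition calg_sort (K : pzRingType) (A : comAlgebra K) : Type := calg_ring A.

Coercion calg_sort : comAlgebra >-> Sortclass.

Section ComAlgebraInstances.
Variables (K : pzRingType) (A : comAlgebra K).

HB.instance Definition _ :=
  GRing.ComPzRing.copy (calg_sort A) (calg_ring A).
HB.instance Definition _ := GRing.Zmodule_isLmodule.Build K (calg_sort A)
  (@calg_scalerA K A) (@calg_scale1r K A) (@calg_scalerDr K A)
  (@calg_scalerDl K A).

Lemma calgAl (k : K) (a b : A) : k *: (a * b) = (k *: a : A) * b.
Proof. exact: calg_scalerAl. Qed.

Definition in_calg (k : K) : A := k *: (1 : A).

Lemma in_calgM (k : K) (a : A) : in_calg k * a = k *: a.
Proof. by rewrite -calgAl mul1r. Qed.

End ComAlgebraInstances.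

(* A module over the K-algebra A is a K-vector space through k |-> in_calg A k;
   this is the K-structure meant by K-linearity of maps to and from
   A-modules. *)

Section Derivations.
Variables (K : fieldType) (A : comAlgebra K) (M : lmodType A).

Definition is_derivation (D : A -> M) : Prop :=
  [/\ forall a b, D (a + b) = D a + D b,
      forall (k : K) a, D (k *: a) = in_calg A k *: D a
    & forall a b, D (a * b) = a *: D b + b *: D a].

Definition derivation_pred : {pred A -> M} := fun D => `[< is_derivation D >].

Lemma derivation_submod_closed : submod_closed derivation_pred.
Proof.
split=> [|c D E /asboolP[Da Dz Dm] /asboolP[Ea Ez Em]]; apply/asboolP.
  by split=> [a b|k a|a b]; rewrite /= ?addr0 ?scaler0 ?addr0.
split=> [a b|k a|a b].
- by rewrite !fctE Da Ea scalerDr addrACA.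
- by rewrite !fctE Dz Ez scalerDr !scalerA mulrC.
- rewrite !fctE Dm Em !scalerDr !scalerA addrACA.
  by rewrite (mulrC c a) (mulrC c b).
Qed.

HB.instance Definition _ := GRing.isSubmodClosed.Build A (A -> M)
  derivation_pred derivation_submod_closed.

Definition derivations := {D : A -> M | D \in derivation_pred}.

HB.instance Definition _ := [isSub of derivations for sval].
HB.instance Definition _ := [Choice of derivations by <:].
HB.instance Definition _ := [SubChoice_isSubLmodule of derivations by <:].

Definition der_fun (D : derivations) : A -> M := val D.

Lemma der_funP (D : derivations) : is_derivation (der_fun D).
Proof. by case: D => D DP; apply/asboolP. Qed.

End Derivations.

Coercion der_fun : derivations >-> Funclass.

Section LeibnizAlgebra.
Variables (K : fieldType) (A : comAlgebra K).

(* A Leibniz A-algebra structure on the A-module B; the bracket is only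
   K-bilinear. *)
Record leibnizAlgebra (B : lmodType A) := LeibnizAlgebra {
  bracket : B -> B -> B;
  bracketDl : forall u v w, bracket (u + v) w = bracket u w + bracket v w;
  bracketDr : forall u v w, bracket u (v + w) = bracket u v + bracket u w;
  bracketZl : forall (k : K) u v,
    bracket (in_calg A k *: u) v = in_calg A k *: bracket u v;
  bracketZr : forall (k : K) u v,
    bracket u (in_calg A k *: v) = in_calg A k *: bracket u v;
  leibniz_identity : forall u v w,
    bracket u (bracket v w) = bracket (bracket u v) w + bracket v (bracket u w)
}.

Notation Der := (derivations A^o).

Lemma commutator_subproof (D E : Der) :
  (fun a => D (E a) - E (D a)) \in @derivation_pred K A A^o.
Proof.
have addZ (F : Der) : [/\ forall a b : A, F (a + b) = F a + F b :> A,
    forall (k : K) (a : A), F (k *: a) = k *: (F a : A) :> A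
  & forall a b : A, F (a * b) = a * F b + b * F a :> A].
  case: (der_funP F) => Fa Fz Fm; split=> // k a.
  by rewrite Fz; exact: in_calgM.
case: (addZ D) => Da Dz Dm; case: (addZ E) => Ea Ez Em {addZ}.
have sumE (x y z t x' z' : A) :
    x + y + (z + t) - (x' + t + (z' + y)) = x - x' + (z - z').
  rewrite (addrACA x y) (addrACA x' t) (addrC t) opprD [LHS]addrACA subrr.
  by rewrite addr0 opprD addrACA.
apply/asboolP; split=> [a b|k a|a b].
- by rewrite Ea Da Da Ea opprD addrACA.
- transitivity (k *: (D (E a) - E (D a) : A)).
    by rewrite scalerBr -Dz -Ez -Ez -Dz.
  by symmetry; exact: in_calgM.
- change (D (E (a * b)) - E (D (a * b)) =
    a * (D (E b) - E (D b)) + b * (D (E a) - E (D a)) :> A).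
  rewrite Em Dm Da Ea !Dm !Em !mulrBr.
  by rewrite (mulrC (D b)) (mulrC (D a)) sumE.
Qed.

Definition commutator (D E : Der) : Der :=
  exist (fun F => F \in @derivation_pred K A A^o) _ (commutator_subproof D E).

Lemma der_eqP (D E : Der) : (forall a, D a = E a) -> D = E.
Proof. by move=> DE; apply/val_inj/funext. Qed.

Lemma commutatorE (D E : Der) (a : A) :
  commutator D E a = D (E a) - E (D a) :> A.
Proof. by []. Qed.

Lemma derD (D : Der) (a b : A) : D (a + b) = D a + D b :> A.
Proof. by case: (der_funP D). Qed.

Lemma derB (D : Der) (a b : A) : D (a - b) = D a - D b :> A.
Proof. by rewrite -{2}(subrK b a) [D (_ - b + b)]derD addrK. Qed.

Lemma derZ (D : Der) (k : K) (a : A) :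
  D (in_calg A k * a) = in_calg A k * D a :> A.
Proof. by case: (der_funP D) => _ Dz _; rewrite in_calgM Dz. Qed.

Lemma der_addE (D E : Der) (a : A) : (D + E : Der) a = D a + E a :> A.
Proof. by []. Qed.

Lemma der_scaleE (D : Der) (b a : A) : (b *: D : Der) a = b * D a :> A.
Proof. by []. Qed.

Lemma commutatorDl (D E F : Der) :
  commutator (D + E) F = commutator D F + commutator E F.
Proof.
apply: der_eqP => a.
by rewrite der_addE !commutatorE !der_addE derD opprD addrACA.
Qed.

Lemma commutatorDr (D E F : Der) :
  commutator D (E + F) = commutator D E + commutator D F.
Proof.
apply: der_eqP => a.
by rewrite der_addE !commutatorE !der_addE derD opprD addrACA.
Qed.

Lemma commutatorZl (k : K) (D E : Der) :
  commutator (in_calg A k *: D) E = in_calg A k *: commutator D E.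
Proof.
apply: der_eqP => a.
by rewrite der_scaleE !commutatorE !der_scaleE derZ mulrBr.
Qed.

Lemma commutatorZr (k : K) (D E : Der) :
  commutator D (in_calg A k *: E) = in_calg A k *: commutator D E.
Proof.
apply: der_eqP => a.
by rewrite der_scaleE !commutatorE !der_scaleE derZ mulrBr.
Qed.

Lemma commutator_leibniz (D E F : Der) :
  commutator D (commutator E F) =
  commutator (commutator D E) F + commutator E (commutator D F).
Proof.
have subE (V : zmodType) (p q r s x y : V) :
    p - q - (r - s) = p - x - (y - s) + (x - r - (q - y)).
  rewrite !opprB [RHS]addrACA !subrKA addrACA [RHS]addrACA.
  by rewrite (addrC (- q)).
by apply: der_eqP => a; rewrite der_addE !commutatorE !derB; exact: subE.
Qed.

Definition Der_leibniz : leibnizAlgebra Der :=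
  LeibnizAlgebra commutatorDl commutatorDr commutatorZl commutatorZr
    commutator_leibniz.

End LeibnizAlgebra.

Notation Der A := (@derivations _ A A^o).

Section LeibnizHomomorphisms.
Variables (K : fieldType) (A : comAlgebra K) (B C : lmodType A).

Record leibnizHom (L : leibnizAlgebra B) (L' : leibnizAlgebra C) :=
  LeibnizHom {
    leibniz_hom :> {linear B -> C};
    leibniz_hom_bracket : forall u v,
      leibniz_hom (bracket L u v) = bracket L' (leibniz_hom u) (leibniz_hom v)
  }.

End LeibnizHomomorphisms.

Section CourantAlgebroid.
Variables (K : fieldType) (A : comAlgebra K).

Record courantAlgebroid (B : lmodType A) := CourantAlgebroid {
  cour_leibniz :> leibnizAlgebra B;
  anchor : leibnizHom cour_leibniz (Der_leibniz A);
  pairing : B -> B -> A;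
  cour_der : derivations B;
  pairing_linearl : forall w (a : A) u v,
    pairing (a *: u + v) w = a * pairing u w + pairing v w;
  pairingC : forall u v, pairing u v = pairing v u;
  anchor_der : forall a : A, anchor (cour_der a) = 0;
  cour_bracket_scale : forall u (a : A) v,
    bracket cour_leibniz u (a *: v) =
      a *: bracket cour_leibniz u v + ((anchor u : Der A) a : A) *: v;
  cour_pairing_bracket : forall u v w,
    pairing (bracket cour_leibniz u v) w + pairing v (bracket cour_leibniz u w)
      = (anchor u : Der A) (pairing v w) :> A;
  cour_bracket_der : forall u (a : A),
    bracket cour_leibniz u (cour_der a) = cour_der ((anchor u : Der A) a);
  cour_pairing_der : forall u (a : A),
    pairing u (cour_der a) = (anchor u : Der A) a;
  cour_bracket_sym : forall u v,
    bracket cour_leibniz u v + bracket cour_leibniz v u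
      = cour_der (pairing u v)
}.

End CourantAlgebroid.

Section VertexAlgebras.
Variable K : fieldType.

(* [nprod n a b] is a_n b, the coefficient of x^{-n-1} in Y_-(a, x) b. *)
Record vertexLie (A : lmodType K) := VertexLie {
  vder : {linear A -> A};
  nprod : nat -> A -> A -> A;
  nprod_linearl : forall n b, linear (nprod n ^~ b);
  nprod_linearr : forall n a, linear (nprod n a);
  nprod_trunc : forall a b, exists N, forall n, (N <= n)%N -> nprod n a b = 0;
  (* For n = 0 the right-hand side is 0, so the value of n.-1 is immaterial. *)
  nprod_vder : forall n a b, nprod n (vder a) b = - (nprod n.-1 a b *+ n);
  (* Skew symmetry: every term with i >= N of the infinite sum vanishes. *)
  nprod_skew : forall n a b N, (forall m, (N <= m)%N -> nprod m b a = 0) ->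
    nprod n a b =
      \sum_(i < N) ((-1) ^+ (n + i + 1) / (i`!)%:R : K)
        *: iter i vder (nprod (n + i) b a);
  nprod_comm : forall m n a b c,
    nprod m a (nprod n b c) - nprod n b (nprod m a c) =
      \sum_(i < m.+1) nprod (m + n - i) (nprod i a b) c *+ 'C(m, i)
}.

Record vertexPoisson (A : comAlgebra K) := VertexPoisson {
  vpoisson_lie :> vertexLie A;
  vder_mul : forall a b : A,
    vder vpoisson_lie (a * b) =
      (vder vpoisson_lie a : A) * b + a * vder vpoisson_lie b;
  nprod_mul : forall n (a b c : A),
    nprod vpoisson_lie n a (b * c) =
      (nprod vpoisson_lie n a b : A) * c + b * nprod vpoisson_lie n a c
}.

(* The sum of the subspaces [piece n] is all of A, and it is direct. That 1
   lies in [piece 0] is a consequence, see [grading_one]. *)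
Record algGrading (A : comAlgebra K) := AlgGrading {
  piece : nat -> {pred A};
  piece_submod : forall n, submod_closed (piece n);
  piece_total : forall a : A, exists N (f : nat -> A),
    (forall i, f i \in piece i) /\ a = \sum_(i < N) f i;
  piece_direct : forall N (f : nat -> A), (forall i, f i \in piece i) ->
    \sum_(i < N) f i = 0 -> forall i, (i < N)%N -> f i = 0;
  piece_mul : forall m n (a b : A), a \in piece m -> b \in piece n ->
    a * b \in piece (m + n)
}.

Record gradedVertexPoisson (A : comAlgebra K) := GradedVertexPoisson {
  gvp_vpoisson :> vertexPoisson A;
  gvp_grading :> algGrading A;
  vder_piece : forall r a, a \in piece gvp_grading r ->
    vder gvp_vpoisson a \in piece gvp_grading r.+1;
  (* a_m A_(r) is contained in A_(r+n-m-1), which is 0 if r+n-m-1 < 0. *)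
  nprod_piece : forall n m r a b,
    a \in piece gvp_grading n -> b \in piece gvp_grading r ->
    (m < r + n)%N ->
    nprod gvp_vpoisson m a b \in piece gvp_grading (r + n - m - 1);
  nprod_piece_neg : forall n m r a b,
    a \in piece gvp_grading n -> b \in piece gvp_grading r ->
    (r + n <= m)%N -> nprod gvp_vpoisson m a b = 0
}.

End VertexAlgebras.

Section GradedPieces.
Variables (K : fieldType) (A : comAlgebra K) (G : algGrading A).

Lemma grading_one : (1 : A) \in piece G 0.
Proof.
have G0 n : (0 : A) \in piece G n by case: (piece_submod G n).
have [N [e [eG e1]]] := piece_total G 1.
have eN x n : x \in piece G n -> (0 < N)%N -> x * e 0%N = x.
  move=> xG N0.
  pose f j := (if (n <= j)%N then x * e (j - n)%N else 0)
              - (if j == n then x else 0) : A.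
  have fG j : f j \in piece G j.
    have GB (y z : A) : y \in piece G j -> z \in piece G j ->
        y - z \in piece G j.
      case: (piece_submod G j) => _ Gl yG zG.
      by rewrite addrC -scaleN1r; exact: Gl.
    apply: GB; last by case: eqP => [->|_].
    by case: leqP => // nj; rewrite -{2}(subnKC nj); exact: piece_mul.
  have f0 : \sum_(j < n + N) f j = 0.
    rewrite sumrB big_split_ord /= big1 ?add0r; last first.
      by move=> i _; rewrite leqNgt ltn_ord.
    rewrite (eq_bigr (fun i : 'I_N => x * e i)) => [|i _]; last first.
      by rewrite leq_addr addKn.
    rewrite -mulr_sumr -e1 mulr1 -big_mkcond /=.
    have nN : (n < n + N)%N by rewrite -{1}(addn0 n) ltn_add2l.
    by rewrite (big_pred1 (Ordinal nN)) ?subrr.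
  have := piece_direct fG f0 (i := n).
  rewrite /f leqnn subnn eqxx -{1}(addn0 n) ltn_add2l => /(_ N0) /eqP.
  by rewrite subr_eq0 => /eqP.
case: (posnP N) => [N0|N0]; first by rewrite e1 N0 big_ord0.
suff -> : (1 : A) = e 0%N by [].
rewrite -[RHS]mul1r e1 mulr_suml; apply: eq_bigr => i _.
by rewrite (eN _ _ (eG i)).
Qed.

Definition piece0 : {pred A} := piece G 0.
Definition piece1 : {pred A} := piece G 1.

Lemma piece0_subring : subring_closed piece0.
Proof.
split; first exact: grading_one.
  by case: (GRing.submod_closedB (piece_submod G 0)).
by move=> a b aG bG; exact: (piece_mul (m := 0) (n := 0)).
Qed.

HB.instance Definition _ :=
  GRing.isSubringClosed.Build A piece0 piece0_subring.
HB.instance Definition _ :=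
  GRing.isZmodClosed.Build A piece1 (GRing.submod_closedB (piece_submod G 1)).

Definition deg0_sort := {a : A | a \in piece0}.
HB.instance Definition _ := [isSub of deg0_sort for sval].
HB.instance Definition _ := [Choice of deg0_sort by <:].
HB.instance Definition _ :=
  GRing.SubChoice_isSubComPzRing.Build A _ deg0_sort piece0_subring.

Lemma deg0_scale_subproof (k : K) (a : deg0_sort) : k *: val a \in piece0.
Proof.
case: (piece_submod G 0) => G0 Gl.
by rewrite -[_ *: _]addr0; apply: Gl => //; exact: valP.
Qed.

Definition deg0_scale (k : K) (a : deg0_sort) : deg0_sort :=
  exist (fun b => b \in piece0) _ (deg0_scale_subproof k a).

Program Definition deg0 : comAlgebra K :=
  @ComAlgebra K deg0_sort deg0_scale _ _ _ _ _.
Next Obligation. by move=> *; apply: val_inj; exact: scalerA. Qed.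
Next Obligation. by move=> *; apply: val_inj; exact: scale1r. Qed.
Next Obligation. by move=> *; apply: val_inj; exact: scalerDr. Qed.
Next Obligation. by move=> *; apply: val_inj; exact: scalerDl. Qed.
Next Obligation. by move=> *; apply: val_inj; exact: calgAl. Qed.

Definition deg1 := {a : A | a \in piece1}.
HB.instance Definition _ := [isSub of deg1 for sval].
HB.instance Definition _ := [Choice of deg1 by <:].
HB.instance Definition _ := [SubChoice_isSubZmodule of deg1 by <:].

Definition deg0_val (a : deg0) : A := val (a : deg0_sort).
Definition deg1_val (u : deg1) : A := val u.

Lemma deg1_scale_subproof (a : deg0) (u : deg1) :
  deg0_val a * deg1_val u \in piece1.
Proof. by apply: (piece_mul (m := 0) (n := 1)); exact: valP. Qed.

Definition deg1_scale (a : deg0) (u : deg1) : deg1 :=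
  exist (fun b => b \in piece1) _ (deg1_scale_subproof a u).

Program Definition deg1_lmodMixin :=
  @GRing.Zmodule_isLmodule.Build deg0 deg1 deg1_scale _ _ _ _.
Next Obligation. by move=> *; apply: val_inj; exact: mulrA. Qed.
Next Obligation. by move=> *; apply: val_inj; exact: mul1r. Qed.
Next Obligation. by move=> *; apply: val_inj; exact: mulrDr. Qed.
Next Obligation. by move=> *; apply: val_inj; exact: mulrDl. Qed.
HB.instance Definition _ := deg1_lmodMixin.

End GradedPieces.

(* Main.v *)
(* For u, v of degree 1 and a of degree 0, the grading leaves only the i <= 1
   terms of skew symmetry: u_0 v = - v_0 u + d (v_1 u), u_1 v = v_1 u and
   u_0 a = - a_0 u. Together with the commutator formula and the Leibniz rule
   for u_n, these give all the Courant algebroid axioms. *)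
Require Import Defs.
From HB Require Import structures.
From mathcomp Require Import all_boot all_order all_algebra.
From mathcomp Require Import boolp.

Set Implicit Arguments.
Unset Strict Implicit.
Unset Printing Implicit Defensive.

Import GRing.Theory.
Local Open Scope ring_scope.

Section VertexLieTheory.
Variables (K : fieldType) (A : lmodType K) (V : vertexLie A).

HB.instance Definition _ n a :=
  GRing.isLinear.Build K A A _ (nprod V n a) (nprod_linearr V n a).

Lemma nprodDl n b : {morph nprod V n ^~ b : u v / u + v}.
Proof. by move=> u v; have := nprod_linearl V n b 1 u v; rewrite !scale1r. Qed.

Lemma nprod0l n b : nprod V n 0 b = 0.
Proof. by apply: (addIr (nprod V n 0 b)); rewrite -nprodDl !add0r. Qed.

Lemma nprodZl n b k u : nprod V n (k *: u) b = k *: nprod V n u b.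
Proof.
by have := nprod_linearl V n b k u 0; rewrite nprod0l !addr0.
Qed.

(** The hypothesis is the truncation bound of [nprod_skew] with [N] equal to 2, so only the terms i
    = 0 and i = 1 remain, with coefficients -1 and 1. *)
Lemma nprod_skew0 a b : (forall m, (1 < m)%N -> nprod V m b a = 0) ->
  nprod V 0 a b = - nprod V 0 b a + vder V (nprod V 1 b a).
Proof.
move=> ba0; rewrite (nprod_skew 0 ba0) !big_ord_recl big_ord0 /= addr0.
by rewrite expr1 sqrrN !expr1n !divr1 scaleN1r scale1r.
Qed.

Lemma nprod_skew00 a b : (forall m, (0 < m)%N -> nprod V m b a = 0) ->
  nprod V 0 a b = - nprod V 0 b a.
Proof.
move=> ba0; rewrite nprod_skew0 => [|m m1]; last by rewrite ba0 // ltnW.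
by rewrite (ba0 1) // linear0 addr0.
Qed.

Lemma nprod_skew1 a b : (forall m, (1 < m)%N -> nprod V m b a = 0) ->
  nprod V 1 a b = nprod V 1 b a.
Proof.
move=> ba0; rewrite (nprod_skew 1 ba0) !big_ord_recl big_ord0 /= addr0.
(* The term i = 1 contains b_2 a, which is already truncated; the surviving term i = 0 has sign
   (-1)^2. *)
by rewrite (ba0 2) // !linear0 addr0 sqrrN expr1n divr1 scale1r.
Qed.

(** At order m = 0 the commutator sum has a single term. For n = 0 this gives the Leibniz identity
    and the compatibility of the anchor with brackets; for n = 1 it gives the invariance of the
    pairing. *)
Lemma nprod0_comm n a b c :
  nprod V 0 a (nprod V n b c) =
    nprod V n (nprod V 0 a b) c + nprod V n b (nprod V 0 a c).
Proof.
apply/eqP; rewrite -subr_eq nprod_comm big_ord_recl big_ord0 addr0 /=.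
by rewrite add0n subn0 bin0.
Qed.

(** The factor n in (d a)_n = - n a_(n-1) is zero here. This yields both the vanishing of the anchor
    on exact elements and [d a, u] = 0. *)
Lemma nprod0_vder a b : nprod V 0 (vder V a) b = 0.
Proof. by rewrite nprod_vder mulr0n oppr0. Qed.

End VertexLieTheory.

Section CourantOfVertexPoisson.
Variables (K : fieldType) (A : comAlgebra K) (V : gradedVertexPoisson A).
Implicit Types (a b : deg0 V) (u v w : deg1 V).

Local Notation v0 := (@deg0_val _ _ V).
Local Notation v1 := (@deg1_val _ _ V).

Lemma deg0_valP a : v0 a \in piece V 0. Proof. exact: valP. Qed.
Lemma deg1_valP u : v1 u \in piece V 1. Proof. exact: valP. Qed.

Lemma deg0_val_inj : injective v0. Proof. exact: val_inj. Qed.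
Lemma deg1_val_inj : injective v1. Proof. exact: val_inj. Qed.

Lemma deg0_valD a b : v0 (a + b) = v0 a + v0 b. Proof. by []. Qed.
Lemma deg0_valB a b : v0 (a - b) = v0 a - v0 b. Proof. by []. Qed.
Lemma deg0_valM a b : v0 (a * b) = v0 a * v0 b. Proof. by []. Qed.
Lemma deg0_valZ (k : K) a : v0 (k *: a) = k *: v0 a. Proof. by []. Qed.
Lemma deg1_valD u v : v1 (u + v) = v1 u + v1 v. Proof. by []. Qed.
Lemma deg1_valZ a u : v1 (a *: u) = v0 a * v1 u. Proof. by []. Qed.
Lemma deg1_val_in_calg (k : K) u :
  v1 (in_calg (deg0 V) k *: u) = k *: v1 u.
Proof. by rewrite deg1_valZ; exact: in_calgM. Qed.

Lemma nprod11 m u v : (1 < m)%N -> nprod V m (v1 u) (v1 v) = 0.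
Proof. exact: nprod_piece_neg (deg1_valP u) (deg1_valP v). Qed.

Lemma nprod10 m u a : (0 < m)%N -> nprod V m (v1 u) (v0 a) = 0.
Proof. exact: nprod_piece_neg (deg1_valP u) (deg0_valP a). Qed.

Lemma nprod01 m a u : (0 < m)%N -> nprod V m (v0 a) (v1 u) = 0.
Proof. exact: nprod_piece_neg (deg0_valP a) (deg1_valP u). Qed.

Lemma nprod00 m a b : nprod V m (v0 a) (v0 b) = 0.
Proof. exact: nprod_piece_neg (deg0_valP a) (deg0_valP b) _. Qed.

Lemma nprod10_skew u a :
  nprod V 0 (v1 u) (v0 a) = - nprod V 0 (v0 a) (v1 u).
Proof. by apply: nprod_skew00 => m; exact: nprod01. Qed.

(** The degree r + n - m - 1 given by [nprod_piece] computes to the required one, and its side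
    condition computes to [true], hence [isT]; the same holds for the pairing and the action
    below. *)
Definition deg1_bracket u v : deg1 V :=
  exist (fun x => x \in piece1 V) (nprod V 0 (v1 u) (v1 v))
    (nprod_piece (m := 0) (deg1_valP u) (deg1_valP v) isT).

Definition deg1_pairing u v : deg0 V :=
  exist (fun x => x \in piece0 V) (nprod V 1 (v1 u) (v1 v))
    (nprod_piece (m := 1) (deg1_valP u) (deg1_valP v) isT).

Definition deg1_action u a : deg0 V :=
  exist (fun x => x \in piece0 V) (nprod V 0 (v1 u) (v0 a))
    (nprod_piece (m := 0) (deg1_valP u) (deg0_valP a) isT).

Definition deg0_vder a : deg1 V :=
  exist (fun x => x \in piece1 V) (vder V (v0 a)) (vder_piece (deg0_valP a)).

Lemma deg1_bracketE u v : v1 (deg1_bracket u v) = nprod V 0 (v1 u) (v1 v).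
Proof. by []. Qed.
Lemma deg1_pairingE u v : v0 (deg1_pairing u v) = nprod V 1 (v1 u) (v1 v).
Proof. by []. Qed.
Lemma deg1_actionE u a : v0 (deg1_action u a) = nprod V 0 (v1 u) (v0 a).
Proof. by []. Qed.
Lemma deg0_vderE a : v1 (deg0_vder a) = vder V (v0 a).
Proof. by []. Qed.

Lemma deg1_action_derivation u :
  deg1_action u \in @derivation_pred K (deg0 V) (deg0 V)^o.
Proof.
apply/asboolP; split=> [a b|k a|a b].
- by apply: deg0_val_inj; rewrite deg0_valD !deg1_actionE deg0_valD linearD.
(* On the regular module, [in_calg] acts by multiplication by k *: 1, which [in_calgM] turns into
   scaling by k. *)
- transitivity (k *: deg1_action u a); last by symmetry; exact: in_calgM.
  by apply: deg0_val_inj; rewrite deg0_valZ !deg1_actionE deg0_valZ linearZ.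
- change (deg1_action u (a * b) =
    a * deg1_action u b + b * deg1_action u a).
  apply: deg0_val_inj; rewrite deg0_valD !deg0_valM !deg1_actionE deg0_valM.
  by rewrite nprod_mul addrC [in LHS](mulrC _ (v0 b)).
Qed.

Definition deg1_anchor u : Der (deg0 V) :=
  exist (fun F => F \in @derivation_pred K (deg0 V) (deg0 V)^o) _
    (deg1_action_derivation u).

Lemma deg1_anchorE u a : (deg1_anchor u a : deg0 V) = deg1_action u a.
Proof. by []. Qed.

(** The Leibniz rule acts on the right argument only, so skew symmetry first moves the degree 1
    element there: b_0 (a u) = (b_0 a) u + a (b_0 u), where b_0 a = 0 by degree. *)
Lemma deg1_anchor_linear : linear deg1_anchor.
Proof.
move=> a u v; apply: der_eqP => b; rewrite der_addE der_scaleE !deg1_anchorE.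
apply: deg0_val_inj; rewrite deg0_valD deg0_valM !deg1_actionE deg1_valD.
rewrite nprodDl; congr (_ + _); rewrite !nprod10_skew deg1_valZ nprod_mul.
by rewrite nprod00 mul0r add0r mulrN.
Qed.

HB.instance Definition _ :=
  GRing.isLinear.Build (deg0 V) (deg1 V) (Der (deg0 V)) _ deg1_anchor
    deg1_anchor_linear.

Lemma deg0_vder_derivation :
  deg0_vder \in @derivation_pred K (deg0 V) (deg1 V).
Proof.
apply/asboolP; split=> [a b|k a|a b]; apply: deg1_val_inj.
- by rewrite deg1_valD !deg0_vderE deg0_valD linearD.
- by rewrite deg1_val_in_calg !deg0_vderE deg0_valZ linearZ.
- rewrite deg1_valD !deg1_valZ !deg0_vderE deg0_valM vder_mul addrC.
  by rewrite [in LHS](mulrC _ (v0 b)).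
Qed.

Definition deg0_der : derivations (deg1 V) :=
  exist (fun F => F \in @derivation_pred K (deg0 V) (deg1 V)) _
    deg0_vder_derivation.

Lemma deg0_derE a : v1 (deg0_der a) = vder V (v0 a). Proof. by []. Qed.

Definition deg1_leibniz : leibnizAlgebra (deg1 V).
Proof.
apply: (@LeibnizAlgebra _ _ _ deg1_bracket).
- by move=> u v w; apply: deg1_val_inj; exact: nprodDl.
- by move=> u v w; apply: deg1_val_inj; exact: linearD.
- move=> k u v; apply: deg1_val_inj.
  by rewrite !(deg1_bracketE, deg1_val_in_calg) nprodZl.
- move=> k u v; apply: deg1_val_inj.
  by rewrite !(deg1_bracketE, deg1_val_in_calg) linearZ.
- by move=> u v w; apply: deg1_val_inj; exact: nprod0_comm.
(* Kept transparent so that [bracket deg1_leibniz] unfolds to [deg1_bracket] by conversion. *)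
Defined.

Lemma deg1_anchor_bracket u v :
  deg1_anchor (bracket deg1_leibniz u v) =
    bracket (Der_leibniz (deg0 V)) (deg1_anchor u) (deg1_anchor v).
Proof.
apply: der_eqP => a; apply: deg0_val_inj.
rewrite [RHS]deg0_valB !deg1_actionE.
by rewrite nprod0_comm addrK.
Qed.

Definition deg1_anchor_hom : leibnizHom deg1_leibniz (Der_leibniz (deg0 V)) :=
  @LeibnizHom _ _ _ _ deg1_leibniz (Der_leibniz (deg0 V)) deg1_anchor
    deg1_anchor_bracket.

Lemma deg1_pairingC u v : deg1_pairing u v = deg1_pairing v u.
Proof. by apply: deg0_val_inj; apply: nprod_skew1 => m; exact: nprod11. Qed.

(** By symmetry the Leibniz rule applies on the right: w_1 (a u) = (w_1 a) u + a (w_1 u), and w_1 a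
    = 0 by degree. *)
Lemma deg1_pairing_linearl w a u v :
  deg1_pairing (a *: u + v) w = a * deg1_pairing u w + deg1_pairing v w.
Proof.
rewrite !(deg1_pairingC _ w); apply: deg0_val_inj.
rewrite deg0_valD deg0_valM !deg1_pairingE deg1_valD linearD deg1_valZ.
by rewrite /= nprod_mul nprod10 // mul0r add0r.
Qed.

(** After swapping the arguments, (d a)_1 u = - a_0 u = u_0 a. *)
Lemma deg1_pairing_der u a : deg1_pairing u (deg0_der a) = deg1_action u a.
Proof.
rewrite deg1_pairingC; apply: deg0_val_inj.
by rewrite deg1_pairingE deg1_actionE deg0_derE nprod_vder nprod10_skew.
Qed.

Lemma deg1_bracket_sym u v :
  deg1_bracket u v + deg1_bracket v u = deg0_der (deg1_pairing u v).
Proof.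
(* The pairing is flipped because skew symmetry of u_0 v produces d (v_1 u). *)
rewrite deg1_pairingC; apply: deg1_val_inj.
rewrite deg1_valD !deg1_bracketE deg0_derE nprod_skew0 => [|m]; last first.
  exact: nprod11.
by rewrite addrAC addNr add0r.
Qed.

(** The symmetrized bracket of u and d a is d of their pairing, that is d (u_0 a), and its second
    summand [d a, u] vanishes. *)
Lemma deg1_bracket_der u a :
  deg1_bracket u (deg0_der a) = deg0_der (deg1_action u a).
Proof.
rewrite -deg1_pairing_der -deg1_bracket_sym.
rewrite [X in _ = _ + X](_ : _ = 0) ?addr0 //.
by apply: deg1_val_inj; rewrite deg1_bracketE nprod0_vder.
Qed.

Definition deg1_courant : courantAlgebroid (deg1 V).
Proof.
apply: (@CourantAlgebroid _ _ _ deg1_leibniz deg1_anchor_hom deg1_pairing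
  deg0_der).
- exact: deg1_pairing_linearl.
- exact: deg1_pairingC.
- move=> a; apply: der_eqP => b; apply: deg0_val_inj.
  exact: nprod0_vder.
- move=> u a v; apply: deg1_val_inj; rewrite deg1_valD !deg1_valZ.
  by rewrite !deg1_bracketE deg1_valZ nprod_mul addrC.
(* Invariance of the pairing is the derivation property of u_0 with respect to the product of index
   1. *)
- by move=> u v w; apply: deg0_val_inj; symmetry; exact: nprod0_comm.
- exact: deg1_bracket_der.
- exact: deg1_pairing_der.
- exact: deg1_bracket_sym.
Defined.

End CourantOfVertexPoisson.

Theorem theorem3p8 (R : realType) (A : comAlgebra R[i])
    (V : gradedVertexPoisson A) :
  exists B : courantAlgebroid (deg1 V),
    [/\ forall u v : deg1 V,
          deg1_val (bracket B u v) = nprod V 0 (deg1_val u) (deg1_val v),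
        forall u v : deg1 V,
          deg0_val (pairing B u v) = nprod V 1 (deg1_val u) (deg1_val v),
        forall (u : deg1 V) (a : deg0 V),
          deg0_val ((anchor B u : Der (deg0 V)) a) =
            nprod V 0 (deg1_val u) (deg0_val a)
      & forall a : deg0 V, deg1_val (cour_der B a) = vder V (deg0_val a)].
Proof. by exists (deg1_courant V). Qed.
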